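(* Let $L$ be a frame and let $X$ be an $L$-valued continuous lattice, equipped with its $L$-valued Scott topology $\sigma_L(X)$. Let $r:\Phi_L(X)\to X$ be given by $r(u)=\sqcup u^l$. Then $(X,r)$ is a $\Phi_L$-algebra (Eilenberg-Moore algebra) over the monad $(\Phi_L,\eta,\mu)$ on $L\text{-}\mathbf{Top}_0$; that is, $r\circ\Phi_L r=r\circ\mu_X$ and $r\circ\eta_X=\mathrm{id}_X$.
   Context: $L$ is a fixed frame (complete Heyting algebra) with implication $a\rightarrow b=\bigvee\{c\mid a\wedge c\le b\}$. An $L$-subset of a set $X$ is a map $X\to L$; $L^X$ carries pointwise order and operations; $a_X$ is the constant map with value $a$. For $f:X\to Y$ and $B\in L^Y$, $f_L^\leftarrow(B)=B\circ f$. $L$-orders. An $L$-order on $X$ is $e:X\times X\to L$ with $e(x,x)=1$; $e(x,y)\wedge e(y,z)\le e(x,z)$; and $e(x,y)\wedge e(y,x)=1$ implies $x=y$. For $A\in L^X$: $A^l(x)=\bigwedge_{y}(A(y)\rightarrow e(x,y))$. An element $x$ is the supremum $\sqcup A$ if $e(x,y)=\bigwedge_{z}(A(z)\rightarrow e(z,y))$ for all $y$. $(X,e)$ is complete if every $L$-subset has a supremum. $D\in L^X$ is directed if $\bigvee_xD(x)=1$ and $D(x)\wedge D(y)\le\bigvee_zD(z)\wedge e(x,z)\wedge e(y,z)$ for all $x,y$; $\mathcal{D}_L(X)$ is the set of directed $L$-subsets. $\mathcal{I}_L(X)$ is the set of ideals, i.e. directed $I$ that are lower sets ($I(x)\wedge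 e(y,x)\le I(y)$ for all $x,y$). For complete $X$, ${\Downarrow}x(y)=\bigwedge_{I\in\mathcal{I}_L(X)}(e(x,\sqcup I)\rightarrow I(y))$; $X$ is an $L$-valued continuous lattice if it is complete and $\sqcup{\Downarrow}x=x$ for all $x$. $A\in L^X$ is Scott open if $A(\sqcup D)=\bigvee_{x}A(x)\wedge D(x)$ for every $D\in\mathcal{D}_L(X)$; the Scott open $L$-subsets form the $L$-valued Scott topology $\sigma_L(X)$. Topology. An $L$-valued topology on $X$ is a family $\mathcal{O}(X)\subseteq L^X$ closed under binary meets and arbitrary joins and containing all $a_X$, $a\in L$. It is $T_0$ if $A(x)=A(y)$ for all $A\in\mathcal{O}(X)$ implies $x=y$. A map $f:X\to Y$ is continuous if $f_L^\leftarrow(B)\in\mathcal{O}(X)$ for all $B\in\mathcal{O}(Y)$. $L\text{-}\mathbf{Top}_0$ is the category of $T_0$ $L$-valued topological spaces and continuous maps. Monad. An open filter of $X$ is a map $u:\mathcal{O}(X)\to L$ with $u(A\wedge B)=u(A)\wedge u(B)$ and $u(a_X)\ge a$ for all $A,B\in\mathcal{O}(X)$, $a\in L$. $\Phi_L(X)$ is the set of open filters; for $A\in\mathcal{O}(X)$, $\phi(A)(u)=u(A)$; $\Phi_L(X)$ carries the $L$-valued topology consisting of all joins $\bigvee_j\phi(A_j)\wedge(a_j)_{\Phi_L(X)}$ with $A_j\in\mathcal{O}(X)$, $a_j\in L$. For continuous $f:X\to Y$, $(\Phi_Lf)(u)(B)=u(f_L^\leftarrow(B))$. $\eta_X(x)=[x]$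 with $[x](B)=B(x)$; $\mu_X:\Phi_L(\Phi_L(X))\to\Phi_L(X)$ is $\mu_X(\alpha)(A)=\alpha(\phi(A))$. $(\Phi_L,\eta,\mu)$ is a monad on $L\text{-}\mathbf{Top}_0$; a $\Phi_L$-algebra is a pair $(X,r)$ with $X$ an object of $L\text{-}\mathbf{Top}_0$ and $r:\Phi_L(X)\to X$ a continuous map with $r\circ\Phi_Lr=r\circ\mu_X$ and $r\circ\eta_X=\mathrm{id}_X$. In the theorem $\mathcal{O}(X)=\sigma_L(X)$, and for $u\in\Phi_L(X)$, $u^l\in L^X$ is $u^l(x)=\bigvee_{A\in\sigma_L(X)}u(A)\wedge A^l(x)$. *)

(* Defs.v *)
From HB Require Import structures.
From mathcomp Require Import all_boot all_order.
From mathcomp Require Import boolp classical_sets.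

Set Implicit Arguments.
Unset Strict Implicit.
Unset Printing Implicit Defensive.

Import Order.TTheory.
Local Open Scope order_scope.

(* MathComp lattices come with a boolean order and a choice operator; under the
   classical axioms of boolp every frame has these, so no frame is excluded. *)
HB.mixin Record isFrame (d : Order.disp_t) L of Order.TBLattice d L := {
  bigjoin : set L -> L ;
  bigjoin_ub : forall (S : set L) (a : L), S a -> a <= bigjoin S ;
  bigjoin_least : forall (S : set L) (b : L),
    (forall a, S a -> a <= b) -> bigjoin S <= b ;
  meet_bigjoin_le : forall (a : L) (S : set L),
    a `&` bigjoin S <= bigjoin [set (a `&` b)%O | b in S]%classic }.

#[short(type="frameType")]
HB.structure Definition Frame (d : Order.disp_t) :=
  { L of Order.TBLattice d L & isFrame d L }.

Section FrameOperations.
Context {d : Order.disp_t} {L : frameType d}.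

Definition joins {I : Type} (D : set I) (F : I -> L) : L :=
  bigjoin (F @` D)%classic.

Definition meets {I : Type} (D : set I) (F : I -> L) : L :=
  bigjoin [set c : L | forall i, D i -> c <= F i]%classic.

Definition imp (a b : L) : L := bigjoin [set c : L | (a `&` c <= b)%O]%classic.

End FrameOperations.

Notation "\Join_ ( i 'in' D ) F" := (joins D%classic (fun i => F))
  (at level 41, F at level 41, i, D at level 50,
   format "'[' \Join_ ( i  'in'  D ) '/  '  F ']'") : order_scope.
Notation "\Join_ ( i : T ) F" := (joins (@setT T) (fun i : T => F))
  (at level 41, F at level 41, i at level 50,
   format "'[' \Join_ ( i  :  T ) '/  '  F ']'") : order_scope.
Notation "\Meet_ ( i 'in' D ) F" := (meets D%classic (fun i => F))
  (at level 41, F at level 41, i, D at level 50,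
   format "'[' \Meet_ ( i  'in'  D ) '/  '  F ']'") : order_scope.
Notation "\Meet_ ( i : T ) F" := (meets (@setT T) (fun i : T => F))
  (at level 41, F at level 41, i at level 50,
   format "'[' \Meet_ ( i  :  T ) '/  '  F ']'") : order_scope.
Notation "a ~~> b" := (imp a b) (at level 55, right associativity) : order_scope.

Section FrameTheory.
Context {d : Order.disp_t} {L : frameType d}.
Implicit Types (a b c : L).

Lemma joins_ub {I : Type} (D : set I) (F : I -> L) i :
  D i -> F i <= \Join_(j in D) F j.
Proof. by move=> Di; apply: bigjoin_ub; exists i. Qed.

Lemma joins_le {I : Type} (D : set I) (F : I -> L) b :
  (forall i, D i -> F i <= b) -> \Join_(j in D) F j <= b.
Proof. by move=> h; apply: bigjoin_least => _ [i Di <-]; exact: h. Qed.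

Lemma le_joins {I : Type} (D : set I) (F : I -> L) b i :
  D i -> b <= F i -> b <= \Join_(j in D) F j.
Proof. by move=> Di bF; apply: le_trans bF _; exact: joins_ub. Qed.

Lemma meets_lb {I : Type} (D : set I) (F : I -> L) i :
  D i -> \Meet_(j in D) F j <= F i.
Proof. by move=> Di; apply: bigjoin_least => c; apply. Qed.

Lemma le_meets {I : Type} (D : set I) (F : I -> L) b :
  (forall i, D i -> b <= F i) -> b <= \Meet_(j in D) F j.
Proof. by move=> h; apply: bigjoin_ub. Qed.

Lemma meet_joinsr {I : Type} (D : set I) (F : I -> L) a :
  a `&` (\Join_(i in D) F i) = \Join_(i in D) (a `&` F i).
Proof.
apply/eqP; rewrite eq_le; apply/andP; split; last first.
  by apply: joins_le => i Di; rewrite leI2 // joins_ub.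
apply: le_trans (meet_bigjoin_le _ _) _; apply: bigjoin_least.
by move=> _ [_ [i Di <-] <-]; exact: (@joins_ub I D (fun i => a `&` F i) _ Di).
Qed.

Lemma meet_joinsl {I : Type} (D : set I) (F : I -> L) a :
  (\Join_(i in D) F i) `&` a = \Join_(i in D) (F i `&` a).
Proof.
rewrite meetC meet_joinsr; congr joins.
by apply/funext => i; rewrite meetC.
Qed.

Lemma imp_adj a b c : (c <= a ~~> b) = (a `&` c <= b).
Proof.
apply/idP/idP => [h|h]; last exact: bigjoin_ub.
apply: le_trans (leI2 (lexx a) h) _.
apply: le_trans (meet_bigjoin_le _ _) _.
by apply: bigjoin_least => _ [e ae <-].
Qed.

End FrameTheory.

Arguments joins_ub {d L I D} F {i} _.
Arguments le_joins {d L I D F b i} _ _.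
Arguments meets_lb {d L I D} F {i} _.

Section LOrders.
Context {d : Order.disp_t} {L : frameType d}.

Record lorder := LOrder {
  lorder_sort :> Type ;
  lord : lorder_sort -> lorder_sort -> L ;
  lord_refl : forall x, lord x x = \top ;
  lord_trans : forall x y z, lord x y `&` lord y z <= lord x z ;
  lord_antisym : forall x y, lord x y `&` lord y x = \top -> x = y }.

(* A^l *)
Definition lower_bounds (X : lorder) (A : X -> L) (x : X) : L :=
  \Meet_(y : X) (A y ~~> lord x y).

Definition is_lsup (X : lorder) (A : X -> L) (x : X) : Prop :=
  forall y, lord x y = \Meet_(z : X) (A z ~~> lord z y).

Definition directed (X : lorder) (D : X -> L) : Prop :=
  \Join_(x : X) D x = \top /\
  forall x y, D x `&` D y <= \Join_(z : X) (D z `&` lord x z `&` lord y z).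

Definition lower_set (X : lorder) (I : X -> L) : Prop :=
  forall x y, I x `&` lord y x <= I y.

Definition ideal (X : lorder) (I : X -> L) : Prop :=
  directed I /\ lower_set I.

Record complete_lorder := CompleteLOrder {
  complete_sort :> lorder ;
  complete_lsup : forall A : complete_sort -> L, exists x, is_lsup A x }.

Definition lsup (X : complete_lorder) (A : X -> L) : X :=
  projT1 (cid (complete_lsup A)).

Lemma lsupP (X : complete_lorder) (A : X -> L) : is_lsup A (lsup A).
Proof. exact: projT2 (cid (complete_lsup A)). Qed.

Lemma is_lsup_uniq (X : lorder) (A : X -> L) (x y : X) :
  is_lsup A x -> is_lsup A y -> x = y.
Proof.
move=> hx hy; apply: lord_antisym.
by rewrite hx -hy lord_refl hy -hx lord_refl meetxx.
Qed.

Definition way_below (X : complete_lorder) (x y : X) : L :=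
  \Meet_(I in [set I : X -> L | ideal I]) (lord x (lsup I) ~~> I y).

(* L-valued continuous lattices *)
Record clattice := CLattice {
  clattice_sort :> complete_lorder ;
  lsup_way_below : forall x : clattice_sort, lsup (way_below x) = x }.

Definition scott_open (X : complete_lorder) (A : X -> L) : Prop :=
  forall D : X -> L, directed D -> A (lsup D) = \Join_(x : X) (A x `&` D x).

End LOrders.

Arguments lorder {d} L.
Arguments complete_lorder {d} L.
Arguments clattice {d} L.

Section LTopologies.
Context {d : Order.disp_t} {L : frameType d}.

(* Spaces are not required to be T0; Top_0 is the full subcategory of those
   satisfying [T0]. *)
Record ltop := LTop {
  ltop_sort :> Type ;
  is_open : set (ltop_sort -> L) ;
  is_openI : forall A B, is_open A -> is_open B ->
    is_open (fun x => A x `&` B x) ;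
  is_open_joins : forall F : set (ltop_sort -> L),
    (forall A, F A -> is_open A) -> is_open (fun x => \Join_(A in F) A x) ;
  is_open_cst : forall a : L, is_open (fun=> a) }.

Definition T0 (X : ltop) : Prop :=
  forall x y : X, (forall A, is_open A -> A x = A y) -> x = y.

(* O(X) *)
Record opens (X : ltop) := Opens {
  opens_fun :> X -> L ;
  opensP : is_open opens_fun }.

Lemma opens_inj (X : ltop) (A B : opens X) : (forall x, A x = B x) -> A = B.
Proof.
case: A B => [A oA] [B oB] /= /funext AB; move: oA oB; rewrite AB => oA oB.
by rewrite (Prop_irrelevance oA oB).
Qed.

Definition opensI (X : ltop) (A B : opens X) : opens X :=
  Opens (is_openI (opensP A) (opensP B)).

Definition opens_cst (X : ltop) (a : L) : opens X := Opens (is_open_cst X a).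

Record cmap (X Y : ltop) := CMap {
  cmap_fun :> X -> Y ;
  cmapP : forall B : Y -> L, is_open B -> is_open (B \o cmap_fun) }.

Definition preim (X Y : ltop) (f : cmap X Y) (B : opens Y) : opens X :=
  Opens (cmapP f (opensP B)).

Record open_filter (X : ltop) := OpenFilter {
  filter_fun :> opens X -> L ;
  filterI : forall A B, filter_fun (opensI A B) = filter_fun A `&` filter_fun B ;
  filter_cst : forall a, a <= filter_fun (opens_cst X a) }.

Lemma filter_inj (X : ltop) (u v : open_filter X) :
  (forall A, u A = v A) -> u = v.
Proof.
case: u v => [u u1 u2] [v v1 v2] /= /funext uv.
move: u1 u2 v1 v2; rewrite uv => u1 u2 v1 v2.
by rewrite (Prop_irrelevance u1 v1) (Prop_irrelevance u2 v2).
Qed.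

Lemma filter_mono (X : ltop) (u : open_filter X) (A B : opens X) :
  (forall x, A x <= B x) -> u A <= u B.
Proof.
move=> AB; suff -> : A = opensI A B by rewrite filterI leIr.
by apply: opens_inj => x /=; rewrite meet_l.
Qed.

Definition phi_fun (X : ltop) (A : opens X) (u : open_filter X) : L := u A.

(* The joins of the \phi(A_j) /\ a_j, a family (A_j, a_j)_j being given by the
   set of its members. *)
Definition Phi_open (X : ltop) : set (open_filter X -> L) :=
  [set W | exists S : set (opens X * L),
     W = (fun u => \Join_(p in S) (phi_fun p.1 u `&` p.2))%O]%classic.

Lemma Phi_openI (X : ltop) (V W : open_filter X -> L) :
  Phi_open V -> Phi_open W -> Phi_open (fun u => V u `&` W u).
Proof.
move=> [S ->] [T ->].
exists [set q | exists p p', [/\ S p, T p' &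
  q = (opensI p.1 p'.1, (p.2 `&` p'.2)%O)]]%classic.
apply/funext => u; apply/eqP; rewrite eq_le; apply/andP; split.
  rewrite meet_joinsl; apply: joins_le => p Sp.
  rewrite meet_joinsr; apply: joins_le => p' Tp'.
  apply: (le_joins (i := (opensI p.1 p'.1, p.2 `&` p'.2))).
    by exists p, p'.
  by rewrite /phi_fun /= filterI meetACA.
apply: joins_le => _ [p [p' [Sp Tp' ->]]] /=.
rewrite /phi_fun filterI meetACA.
by apply: leI2; [apply: (le_joins Sp) | apply: (le_joins Tp')].
Qed.

Lemma Phi_open_joins (X : ltop) (F : set (open_filter X -> L)) :
  (forall W, F W -> Phi_open W) -> Phi_open (fun u => \Join_(W in F) W u).
Proof.
move=> Fo.
exists [set p | exists2 W, F W & forall u, (phi_fun p.1 u `&` p.2 <= W u)%O]%classic.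
apply/funext => u; apply/eqP; rewrite eq_le; apply/andP; split.
  apply: joins_le => W FW; have [S WE] := Fo _ FW.
  rewrite {1}WE; apply: joins_le => p Sp; apply: (le_joins (i := p)) => //.
  by exists W => // v; rewrite WE; exact: (le_joins Sp).
by apply: joins_le => p [W FW pW]; apply: (le_joins FW).
Qed.

Lemma Phi_open_cst (X : ltop) (a : L) :
  Phi_open (fun _ : open_filter X => a).
Proof.
exists [set (opens_cst X \top, a)]%classic; apply/funext => u.
have h : u (opens_cst X \top) = \top.
  by apply/eqP; rewrite -le1x; exact: filter_cst.
apply/eqP; rewrite eq_le; apply/andP; split.
  by apply: (le_joins (i := (opens_cst X \top, a))); rewrite // /phi_fun h meet1x.
by apply: joins_le => _ ->; rewrite leIr.
Qed.

Definition Phi (X : ltop) : ltop :=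
  LTop (@Phi_openI X) (@Phi_open_joins X) (@Phi_open_cst X).

Lemma phi_open (X : ltop) (A : opens X) : Phi_open (phi_fun A).
Proof.
exists [set (A, \top)]%classic; apply/funext => u.
apply/eqP; rewrite eq_le; apply/andP; split.
  by apply: (le_joins (i := (A, \top))); rewrite //= meetx1.
by apply: joins_le => _ ->; rewrite meetx1.
Qed.

Definition phi (X : ltop) (A : opens X) : opens (Phi X) :=
  @Opens (Phi X) (phi_fun A) (phi_open A).

Lemma Phi_T0 (X : ltop) : T0 (Phi X).
Proof. by move=> u v h; apply: filter_inj => A; exact: h (phi_open A). Qed.

(* To get continuity of a map into [Phi Y] it is enough to look at the
   subbasic open L-subsets [phi B]. *)
Lemma Phi_continuous (X Y : ltop) (f : X -> Phi Y) :
  (forall B : opens Y, is_open (phi B \o f)) ->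
  forall W, is_open W -> is_open (W \o f).
Proof.
move=> fo _ [S ->].
pose F : set (X -> L) :=
  [set V | exists2 p, S p & V = (fun x => phi_fun p.1 (f x) `&` p.2)%O]%classic.
suff -> : (fun u => \Join_(p in S) (phi_fun p.1 u `&` p.2)) \o f =
          (fun x => \Join_(V in F) V x).
  apply: is_open_joins => _ [p Sp ->].
  by apply: is_openI; [exact: fo | exact: is_open_cst].
apply/funext => x /=; apply/eqP; rewrite eq_le; apply/andP; split.
  apply: joins_le => p Sp.
  by apply: (le_joins (i := fun x => phi_fun p.1 (f x) `&` p.2)) => //; exists p.
by apply: joins_le => _ [p Sp ->]; apply: (le_joins Sp).
Qed.

Section PhiMap.
Variables (X Y : ltop) (f : cmap X Y).

Definition Phi_map_fun (u : Phi X) : Phi Y.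
Proof.
exists (fun B => u (preim f B)).
- move=> A B; rewrite -filterI; congr (filter_fun u _); exact: opens_inj.
- move=> a; apply: le_trans (filter_cst u a) _; exact: filter_mono.
Defined.

Lemma Phi_map_continuous W : is_open W -> is_open (W \o Phi_map_fun).
Proof. by apply: Phi_continuous => B; exact: (phi_open (preim f B)). Qed.

Definition Phi_map : cmap (Phi X) (Phi Y) := CMap Phi_map_continuous.

End PhiMap.

Section Unit.
Variable X : ltop.

Definition eta_fun (x : X) : Phi X.
Proof. by exists (fun B : opens X => B x). Defined.

Lemma eta_continuous W : is_open W -> is_open (W \o eta_fun).
Proof. by apply: Phi_continuous => B; exact: (opensP B). Qed.

Definition eta : cmap X (Phi X) := CMap eta_continuous.

End Unit.

Section Multiplication.
Variable X : ltop.

Definition mu_fun (alpha : Phi (Phi X)) : Phi X.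
Proof.
exists (fun A => alpha (phi A)).
- move=> A B; rewrite -filterI; congr (filter_fun alpha _).
  by apply: opens_inj => u /=; exact: filterI.
- move=> a; apply: le_trans (filter_cst alpha a) _.
  by apply: filter_mono => u; exact: filter_cst.
Defined.

Lemma mu_continuous W : is_open W -> is_open (W \o mu_fun).
Proof. by apply: Phi_continuous => A; exact: (phi_open (phi A)). Qed.

Definition mu : cmap (Phi (Phi X)) (Phi X) := CMap mu_continuous.

End Multiplication.

Definition cmap_id (X : ltop) : cmap X X := @CMap X X id (fun _ Bo => Bo).

Definition cmap_comp (X Y Z : ltop) (g : cmap Y Z) (f : cmap X Y) : cmap X Z :=
  @CMap X Z (g \o f) (fun B Bo => cmapP f (cmapP g Bo)).

Lemma Phi_map_id (X : ltop) : Phi_map (cmap_id X) =1 id.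
Proof.
by move=> u; apply: filter_inj => A; congr (filter_fun u _); exact: opens_inj.
Qed.

Lemma Phi_map_comp (X Y Z : ltop) (g : cmap Y Z) (f : cmap X Y) :
  Phi_map (cmap_comp g f) =1 Phi_map g \o Phi_map f.
Proof.
by move=> u; apply: filter_inj => A; congr (filter_fun u _); exact: opens_inj.
Qed.

Lemma eta_natural (X Y : ltop) (f : cmap X Y) :
  Phi_map f \o eta X =1 eta Y \o f.
Proof. by move=> x; exact: filter_inj. Qed.

Lemma mu_natural (X Y : ltop) (f : cmap X Y) :
  Phi_map f \o mu X =1 mu Y \o Phi_map (Phi_map f).
Proof.
move=> a; apply: filter_inj => A /=.
by congr (filter_fun a _); exact: opens_inj.
Qed.

Lemma mu_eta (X : ltop) : mu X \o eta (Phi X) =1 id.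
Proof. by move=> u; exact: filter_inj. Qed.

Lemma mu_Phi_eta (X : ltop) : mu X \o Phi_map (eta X) =1 id.
Proof.
by move=> u; apply: filter_inj => A; congr (filter_fun u _); exact: opens_inj.
Qed.

Lemma mu_mu (X : ltop) : mu X \o Phi_map (mu X) =1 mu X \o mu (Phi X).
Proof.
move=> a; apply: filter_inj => A /=.
by congr (filter_fun a _); exact: opens_inj.
Qed.

Definition Phi_algebra (X : ltop) (r : Phi X -> X) : Prop :=
  T0 X /\
  exists2 r' : cmap (Phi X) X, cmap_fun r' = r &
    r' \o Phi_map r' = r' \o mu X /\ r' \o eta X = id.

End LTopologies.

Section ScottTopology.
Context {d : Order.disp_t} {L : frameType d} (X : complete_lorder L).

Lemma scott_open_upper (A : X -> L) : scott_open A ->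
  forall x y, A x `&` lord x y <= A y.
Proof.
move=> Ao x y; pose D (w : X) : L := lord w y.
have yD : is_lsup D y.
  move=> z; apply/eqP; rewrite eq_le; apply/andP; split.
    by apply: le_meets => w _; rewrite imp_adj lord_trans.
  have := meets_lb (D := setT) (fun w => D w ~~> lord w z) (i := y) I.
  by rewrite imp_adj /D lord_refl meet1x.
have dD : directed D.
  split.
    apply/eqP; rewrite -le1x.
    by apply: (le_joins (i := y)); rewrite // /D lord_refl.
  move=> v w; apply: (le_joins (i := y)) => //.
  by rewrite /D lord_refl meet1x.
rewrite -{2}(is_lsup_uniq (lsupP D) yD) (Ao _ dD).
exact: (le_joins (i := x)).
Qed.

Lemma scott_openI (A B : X -> L) :
  scott_open A -> scott_open B -> scott_open (fun x => A x `&` B x).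
Proof.
move=> Ao Bo D dD; rewrite (Ao _ dD) (Bo _ dD).
apply/eqP; rewrite eq_le; apply/andP; split; last first.
  apply: joins_le => x _; rewrite lexI; apply/andP; split.
    by apply: (le_joins (i := x)); rewrite // leI2 // leIl.
  by apply: (le_joins (i := x)); rewrite // leI2 // leIr.
rewrite meet_joinsl; apply: joins_le => x _.
rewrite meet_joinsr; apply: joins_le => y _.
rewrite meetACA; apply: le_trans (leI2 (lexx _) (dD.2 x y)) _.
rewrite meet_joinsr; apply: joins_le => z _; apply: (le_joins (i := z)) => //.
rewrite -[D z `&` _ `&` _]meetA [D z `&` _]meetC meetA meetACA.
by rewrite leI2 // leI2 // scott_open_upper.
Qed.

Lemma scott_open_joins (F : set (X -> L)) :
  (forall A, F A -> scott_open A) ->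
  scott_open (fun x => \Join_(A in F) A x).
Proof.
move=> Fo D dD; apply/eqP; rewrite eq_le; apply/andP; split.
  apply: joins_le => A FA; rewrite (Fo _ FA _ dD).
  apply: joins_le => x _; apply: (le_joins (i := x)) => //.
  by rewrite leI2 //; apply: (le_joins FA).
apply: joins_le => x _; rewrite meet_joinsl; apply: joins_le => A FA.
by apply: (le_joins FA); rewrite (Fo _ FA _ dD); apply: (le_joins (i := x)).
Qed.

Lemma scott_open_cst (a : L) : scott_open (fun _ : X => a).
Proof. by move=> D dD; rewrite -meet_joinsr dD.1 meetx1. Qed.

Definition scott : ltop :=
  LTop scott_openI scott_open_joins scott_open_cst.

(* u^l *)
Definition filter_lower (u : Phi scott) (x : X) : L :=
  \Join_(A : opens scott) (u A `&` lower_bounds A x).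

End ScottTopology.

(* Main.v *)
(** Write [x << y] for [way_below y x]. In a continuous lattice [<<]
    interpolates, so each [y |-> (x << y)] is Scott open, and a Scott open [A]
    satisfies [A x = \/_y A y /\ (y << x)]. As [u^l] is directed,
    [A (r u) = \/_(B, x) u B /\ A x /\ B^l x], which gives continuity of [r] at
    once; from it, [A (r u) <= u A] and
    [u A /\ A^l x /\ (y << x) <= (y << r u)], and applying a filter of filters
    to these two inequalities gives [r \o Phi r = r \o mu]. *)
From mathcomp Require Import all_boot all_order.
From mathcomp Require Import boolp.
Import Order.TTheory.
(* Imported last: [Order.TTheory] has its own [joins_le], among others. *)
Require Import Defs.

Set Implicit Arguments.
Unset Strict Implicit.
Unset Printing Implicit Defensive.

Local Open Scope order_scope.

(** * Forcing-style reasoning in a frame *)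

Section Frames.
Context {d : Order.disp_t} {L : frameType d}.
Implicit Types (a b c : L).

(* Inequalities are proved by forcing: [c <= a] reads "a holds at stage c", and
   joins are eliminated by passing to smaller stages, as here. *)
Lemma joins_elim {I : Type} (F : I -> L) c b :
  c <= \Join_(i : I) F i ->
  (forall i c', c' <= c -> c' <= F i -> c' <= b) -> c <= b.
Proof.
move=> cF h; rewrite -(meet_l cF) meet_joinsr; apply: joins_le => i _.
by apply: (h i); [exact: leIl | exact: leIr].
Qed.

Lemma le_forced a b : (forall c, c <= a -> c <= b) -> a <= b.
Proof. by apply. Qed.

Lemma imp_elim a b c : c <= a ~~> b -> c <= a -> c <= b.
Proof. by rewrite imp_adj => h ca; apply: le_trans h; rewrite lexI ca lexx. Qed.

Lemma imp_intro a b c : (forall c', c' <= c -> c' <= a -> c' <= b) ->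
  c <= a ~~> b.
Proof. by move=> h; rewrite imp_adj; apply: h; [exact: leIr | exact: leIl]. Qed.

Lemma lord_transW (X : lorder L) (x y z : X) c :
  c <= lord x y -> c <= lord y z -> c <= lord x z.
Proof. by move=> xy yz; apply: le_trans (lord_trans x y z); rewrite lexI xy. Qed.

End Frames.

(** * Lower sets and lower bounds at a stage *)

Section LowerBounds.
Context {d : Order.disp_t} {L : frameType d} (X : lorder L).
Implicit Types (A B I : X -> L) (x y z : X).

Lemma lower_setW I x y (c : L) :
  lower_set I -> c <= I x -> c <= lord y x -> c <= I y.
Proof. by move=> lI Ix yx; apply: le_trans (lI x y); rewrite lexI Ix. Qed.

Lemma lower_boundsP A x (c : L) :
  reflect (forall y c', c' <= c -> c' <= A y -> c' <= lord x y)
    (c <= lower_bounds A x).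
Proof.
apply: (iffP idP) => [cA y c' c'c|h].
  apply: imp_elim; apply: le_trans c'c (le_trans cA _).
  exact: (meets_lb (fun y => A y ~~> lord x y)).
by apply: le_meets => y _; apply: imp_intro; exact: h.
Qed.

End LowerBounds.

(** * Suprema in complete L-orders *)

Section CompleteOrders.
Context {d : Order.disp_t} {L : frameType d} (X : complete_lorder L).
Implicit Types (A D I : X -> L) (x y z : X).

Lemma le_lord_lsup A y (c : L) :
  reflect (forall z c', c' <= c -> c' <= A z -> c' <= lord z y)
    (c <= lord (lsup A) y).
Proof.
rewrite (lsupP A y); apply: (iffP idP) => [cA z c' c'c|h].
  apply: imp_elim; apply: le_trans c'c (le_trans cA _).
  exact: (meets_lb (fun z => A z ~~> lord z y)).
by apply: le_meets => z _; apply: imp_intro; exact: h.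
Qed.

Lemma lsup_ub A x : A x <= lord x (lsup A).
Proof.
have /le_lord_lsup h : \top <= lord (lsup A) (lsup A) by rewrite lord_refl.
by apply: h; rewrite ?lex1.
Qed.

Lemma lord_top_antisym x y : \top <= lord x y -> \top <= lord y x -> x = y.
Proof.
by rewrite !le1x => /eqP xy /eqP yx; apply: lord_antisym; rewrite xy yx meetxx.
Qed.

(** * Finite joins and ideals *)

Definition lbot : X := lsup (fun=> \bot).

Lemma lord_lbot x (c : L) : c <= lord lbot x.
Proof.
by apply/le_lord_lsup => z c' _ c'0; apply: le_trans c'0 (le0x _).
Qed.

(** The [L]-subset inside is the lower set generated by [x] and [y], so its supremum is their binary
    join. *)
Definition ljoin x y : X := lsup (fun z => lord z x `|` lord z y).

Lemma lord_ljoinl x y (c : L) : c <= lord x (ljoin x y).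
Proof.
apply: le_trans (lsup_ub _ _).
by rewrite lord_refl join1x lex1.
Qed.

Lemma lord_ljoinr x y (c : L) : c <= lord y (ljoin x y).
Proof.
apply: le_trans (lsup_ub _ _).
by rewrite lord_refl joinx1 lex1.
Qed.

Lemma ljoin_lub x y z (c : L) :
  c <= lord x z -> c <= lord y z -> c <= lord (ljoin x y) z.
Proof.
move=> xz yz; apply/le_lord_lsup => w c' c'c c'w.
(* A stage below a binary join need not lie below either side. Moving [c] into an implication lets
   [leUx] split the join. *)
suff: lord w x `|` lord w y <= c ~~> lord w z.
  by move=> /(le_trans c'w) h; exact: imp_elim h c'c.
by rewrite leUx; apply/andP; split; apply: imp_intro => c'' c''w c''c;
  apply: lord_transW c''w (le_trans c''c _).
Qed.

Lemma ideal_lbot I (c : L) : ideal I -> c <= I lbot.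
Proof.
move=> [[I1 _] lI]; apply: (joins_elim (F := I)); first by rewrite I1 lex1.
by move=> x c' _ c'x; apply: lower_setW lI c'x (lord_lbot _ _).
Qed.

Lemma ideal_ljoin I x y (c : L) :
  ideal I -> c <= I x -> c <= I y -> c <= I (ljoin x y).
Proof.
move=> [[_ dI] lI] Ix Iy.
have /le_trans/(_ (dI x y)) : c <= I x `&` I y by rewrite lexI Ix.
move=> /joins_elim; apply=> z c' c'c; rewrite !lexI => /andP[/andP[Iz xz] yz].
by apply: lower_setW lI Iz (ljoin_lub xz yz).
Qed.

(** [ljoin x y] is the upper bound that directedness asks for, so ideals can be handled through
    closure under finite joins. *)
Lemma idealI I : lower_set I -> (\top <= I lbot) ->
  (forall x y (c : L), c <= I x -> c <= I y -> c <= I (ljoin x y)) -> ideal I.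
Proof.
move=> lI I0 IU; split=> //; split.
  by apply/eqP; rewrite -le1x; apply: le_joins I0.
move=> x y; apply: (le_joins (i := ljoin x y)) => //.
by rewrite !lexI lord_ljoinl lord_ljoinr IU ?leIl ?leIr.
Qed.

(** * The way-below relation and generated ideals *)

Lemma way_belowP x y (c : L) :
  reflect (forall I c', ideal I -> c' <= c -> c' <= lord x (lsup I) -> c' <= I y)
    (c <= way_below x y).
Proof.
apply: (iffP idP) => [cw I c' iI c'c|h].
  apply: imp_elim; apply: le_trans c'c (le_trans cw _).
  exact: (meets_lb (D := fun I => ideal I) (fun I => lord x (lsup I) ~~> I y)).
by apply: le_meets => I iI; apply: imp_intro => c' c'c; exact: h.
Qed.

Lemma way_below_mono x y x' y' (c : L) : c <= way_below x y ->
  c <= lord x x' -> c <= lord y' y -> c <= way_below x' y'.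
Proof.
move=> /way_belowP w xx' y'y; apply/way_belowP => I c' iI c'c x'I.
apply: lower_setW iI.2 _ (le_trans c'c y'y).
by apply: w => //; apply: lord_transW x'I; apply: le_trans xx'.
Qed.

(** [way_below x] is a meet of implications into ideals. Closure under finite joins passes through
    such a meet, which is not clear for directedness as defined. *)
Lemma ideal_way_below x : ideal (way_below x).
Proof.
apply: idealI.
- move=> y z; apply: le_forced => c; rewrite lexI => /andP[w zy].
  by apply: way_below_mono w _ zy; rewrite lord_refl lex1.
- by apply/way_belowP => I c' iI _ _; exact: ideal_lbot.
move=> y z c /way_belowP wy /way_belowP wz; apply/way_belowP => I c' iI c'c xI.
by apply: ideal_ljoin => //; [exact: wy | exact: wz].
Qed.

Lemma scott_openW A x y (c : L) :
  scott_open A -> c <= A x -> c <= lord x y -> c <= A y.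
Proof.
by move=> oA Ax xy; apply: le_trans (scott_open_upper oA x y); rewrite lexI Ax.
Qed.

(** Scott openness is tested on directed [L]-subsets, [way_below] on ideals; passing from [D] to the
    lower set it generates links the two. *)
Definition down D (y : X) : L := \Join_(x : X) (D x `&` lord y x).

Lemma ideal_down D : directed D -> ideal (down D).
Proof.
move=> [D1 dD]; split; last first.
  move=> x y; apply: le_forced => c; rewrite lexI => /andP[cx yx].
  move: cx => /joins_elim; apply=> z c' c'c; rewrite lexI => /andP[Dz xz].
  apply: (le_joins (i := z)) => //; rewrite lexI Dz.
  by apply: lord_transW xz; apply: le_trans yx.
have D_down x : D x <= down D x.
  by apply: (le_joins (i := x)); rewrite // lord_refl meetx1.
split.
  apply/eqP; rewrite -le1x -D1; apply: joins_le => x _.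
  exact: (le_joins (i := x)).
move=> x y; apply: le_forced => c; rewrite lexI => /andP[cx cy].
move: cx => /joins_elim; apply=> x' c1 c1c; rewrite lexI => /andP[Dx' xx'].
have /joins_elim := le_trans c1c cy.
apply=> y' c2 c21; rewrite lexI => /andP[Dy' yy'].
have /le_trans/(_ (dD x' y')) : c2 <= D x' `&` D y'.
  by rewrite lexI Dy' (le_trans c21 Dx').
move=> /joins_elim; apply=> z c3 c32; rewrite !lexI => /andP[/andP[Dz x'z] y'z].
apply: (le_joins (i := z)) => //; rewrite !lexI (le_trans Dz (D_down _)) /=.
apply/andP; split.
  by apply: lord_transW x'z; apply: le_trans xx'; apply: le_trans c21.
by apply: lord_transW y'z; apply: le_trans yy'.
Qed.

Lemma lsup_down D : lsup (down D) = lsup D.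
Proof.
apply: lord_top_antisym; apply/le_lord_lsup => x c _.
  move=> /joins_elim; apply=> y c' _; rewrite lexI => /andP[Dy xy].
  by apply: lord_transW xy (le_trans Dy (lsup_ub _ _)).
move=> Dx; apply: le_trans (lsup_ub _ _); apply: (le_joins (i := x)) => //.
by rewrite lord_refl meetx1.
Qed.

(** * The limit of an open filter *)

Lemma ideal_filter_lower (u : Phi (scott X)) : ideal (filter_lower u).
Proof.
apply: idealI.
- move=> x y; apply: le_forced => c; rewrite lexI => /andP[ux yx].
  move: ux => /joins_elim; apply=> A c' c'c; rewrite lexI => /andP[uA Ax].
  apply: (le_joins (i := A)) => //; rewrite lexI uA; apply/lower_boundsP.
  move=> z c'' c''c' Az; apply: (lord_transW (y := x)).
    by apply: le_trans yx; apply: le_trans c'c.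
  by move/lower_boundsP: Ax; apply.
- apply: (le_joins (i := opens_cst (scott X) \top)) => //; rewrite lexI.
  rewrite filter_cst; apply/lower_boundsP => y c' _ _; exact: lord_lbot.
move=> x y c /joins_elim h cy; apply: h => A c1 c1c; rewrite lexI => /andP[uA Ax].
have /joins_elim := le_trans c1c cy.
apply=> B c2 c21; rewrite lexI => /andP[uB By].
(* The join of a lower bound of [A] and one of [B] is a lower bound of their meet, and [u] preserves
   that meet. *)
apply: (le_joins (i := opensI A B)) => //.
rewrite filterI !lexI uB (le_trans c21 uA); apply/lower_boundsP => z c3 c32 /=.
rewrite lexI => /andP[Az Bz]; apply: ljoin_lub.
  by move/lower_boundsP: Ax; apply=> //; exact: le_trans c32 c21.
by move/lower_boundsP: By; apply.
Qed.

Lemma open_lsup_filter_lower (A : opens (scott X)) (u : Phi (scott X)) :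
  A (lsup (filter_lower u)) =
  \Join_(p : opens (scott X) * X) (u p.1 `&` (A p.2 `&` lower_bounds p.1 p.2)).
Proof.
have oA : scott_open A := opensP A.
rewrite (oA _ (ideal_filter_lower u).1); apply/eqP; rewrite eq_le.
apply/andP; split.
  apply: joins_le => x _; rewrite meet_joinsr; apply: joins_le => B _.
  by apply: (le_joins (i := (B, x))); rewrite // meetCA.
apply: joins_le => -[B x] _ /=; apply: (le_joins (i := x)) => //.
by rewrite meetCA leI2 //; apply: (le_joins (i := B)).
Qed.

(** In [open_lsup_filter_lower] only [u p.1] depends on [u]; the other factor is a constant, so the
    join already has the form of an open of [Phi]. *)
Lemma lsup_filter_lower_continuous (A : scott X -> L) : is_open A ->
  @is_open _ _ (Phi (scott X)) (A \o (fun u => lsup (filter_lower u))).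
Proof.
move=> oA; exists (fun q => exists2 p : opens (scott X) * X, True &
  q = (p.1, A p.2 `&` lower_bounds p.1 p.2)).
apply/funext => u; rewrite [LHS](open_lsup_filter_lower (Opens oA)).
apply/eqP; rewrite eq_le; apply/andP; split.
  apply: joins_le => p _.
  by apply: (le_joins (i := (p.1, A p.2 `&` lower_bounds p.1 p.2))) => //; exists p.
by apply: joins_le => _ [p _ ->]; apply: (le_joins (i := p)).
Qed.

Definition filter_limit : cmap (Phi (scott X)) (scott X) :=
  CMap lsup_filter_lower_continuous.

Lemma open_filter_limit_le (A : opens (scott X)) (u : Phi (scott X)) :
  A (filter_limit u) <= u A.
Proof.
rewrite open_lsup_filter_lower; apply: joins_le => -[B x] _ /=.
set a := A x `&` _.
(* The scalar [a] enters the filter as a constant open. Then [B] meet [a] lies below [A]: where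
   [B z] holds, [x] is below [z], and [A] is an upper set. *)
apply: le_trans (leI2 (lexx _) (filter_cst u a)) _; rewrite -filterI.
apply: filter_mono => z /=; apply: le_forced => c.
rewrite /a !lexI => /and3P[Bz Ax Bx]; apply: scott_openW (opensP A) Ax _.
by move/lower_boundsP: Bx; apply.
Qed.

End CompleteOrders.

(** * Interpolation in continuous lattices *)

Section ContinuousLattices.
Context {d : Order.disp_t} {L : frameType d} (X : clattice L).
Implicit Types (A : X -> L) (x y z : X).

Lemma way_below_lord x y : way_below x y <= lord y x.
Proof. by rewrite -{2}(lsup_way_below x); exact: lsup_ub. Qed.

(** The right side, as a function [J] of [y], is an ideal. Its supremum is above [x], since [x] is
    the supremum of all [z << x] and each [z] that of all [w << z]; so [J] is a test ideal for
    [way_below x]. *)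
Lemma way_below_interpolation x y :
  way_below x y <= \Join_(z : X) (way_below x z `&` way_below z y).
Proof.
pose J y := \Join_(z : X) (way_below x z `&` way_below z y).
have iJ : ideal J.
  apply: idealI.
  - move=> v w; apply: le_forced => c; rewrite lexI => /andP[Jv wv].
    move: Jv => /joins_elim; apply=> z c' c'c; rewrite lexI => /andP[xz zv].
    apply: (le_joins (i := z)) => //; rewrite lexI xz.
    exact: lower_setW (ideal_way_below z).2 zv (le_trans c'c wv).
  - apply: (le_joins (i := lbot X)) => //.
    by rewrite lexI !ideal_lbot //; exact: ideal_way_below.
  move=> v w c /joins_elim h Jw; apply: h => z c1 c1c.
  rewrite lexI => /andP[xz zv].
  have /joins_elim := le_trans c1c Jw.
  apply=> z' c2 c21; rewrite lexI => /andP[xz' z'w].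
  apply: (le_joins (i := ljoin z z')) => //; rewrite lexI; apply/andP; split.
    by apply: ideal_ljoin (ideal_way_below x) _ xz'; exact: le_trans xz.
  apply: ideal_ljoin (ideal_way_below _) _ _.
    apply: (way_below_mono (le_trans c21 zv) (lord_ljoinl _ _ _)).
    by rewrite lord_refl lex1.
  by apply: (way_below_mono z'w (lord_ljoinr _ _ _)); rewrite lord_refl lex1.
apply: le_forced => c /way_belowP h; apply: (h J c iJ (lexx _)).
rewrite -{1}(lsup_way_below x); apply/le_lord_lsup => z c' _ xz.
rewrite -{1}(lsup_way_below z); apply/le_lord_lsup => w c'' c''c' zw.
apply: le_trans (lsup_ub _ _); apply: (le_joins (i := z)) => //.
by rewrite lexI zw (le_trans c''c' xz).
Qed.

(** Interpolate [y << z << lsup D]. Then [z] lies in [down D], hence below some [x] in [D], and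
    [y << x] follows. *)
Lemma scott_open_way_below y : scott_open (fun x : X => way_below x y).
Proof.
move=> D dD; apply/eqP; rewrite eq_le; apply/andP; split; last first.
  apply: joins_le => x _; apply: le_forced => c; rewrite lexI => /andP[xy Dx].
  apply: way_below_mono xy (le_trans Dx (lsup_ub _ _)) _.
  by rewrite lord_refl lex1.
apply: le_trans (way_below_interpolation _ _) _; apply: joins_le => z _.
apply: le_forced => c; rewrite lexI => /andP[/way_belowP wz zy].
have : c <= down D z.
  apply: wz (ideal_down dD) (lexx _) _.
  by rewrite lsup_down lord_refl lex1.
move=> /joins_elim; apply=> x c' c'c; rewrite lexI => /andP[Dx zx].
apply: (le_joins (i := x)) => //; rewrite lexI Dx andbT.
apply: way_below_mono (le_trans c'c zy) zx _.
by rewrite lord_refl lex1.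
Qed.

Definition way_above y : opens (scott X) :=
  @Opens _ _ (scott X) _ (scott_open_way_below y).

Lemma lower_bounds_way_above y (c : L) : c <= lower_bounds (way_above y) y.
Proof.
by apply/lower_boundsP => z c' _ yz; apply: le_trans yz (way_below_lord _ _).
Qed.

Lemma scott_open_way_belowE A x :
  scott_open A -> A x = \Join_(y : X) (A y `&` way_below x y).
Proof.
by move=> oA; rewrite -{1}(lsup_way_below x) (oA _ (ideal_way_below x).1).
Qed.

(** * Separation and the algebra laws *)

Lemma scott_T0 : T0 (scott X).
Proof.
move=> x y h; rewrite -(lsup_way_below x) -(lsup_way_below y).
by congr lsup; apply/funext => z; exact: h (scott_open_way_below z).
Qed.

Lemma filter_limit_eta x : filter_limit X (eta (scott X) x) = x.
Proof.
apply: lord_top_antisym.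
  apply/le_lord_lsup => y c _ /joins_elim; apply=> A c' _.
  by rewrite lexI => /andP[Ax /lower_boundsP]; apply.
rewrite -{1}(lsup_way_below x); apply/le_lord_lsup => y c _ xy.
(* For [y << x], the open [way_above y] holds at [x] and has [y] as a lower bound. *)
apply: le_trans (lsup_ub _ _); apply: (le_joins (i := way_above y)) => //.
by rewrite lexI xy lower_bounds_way_above.
Qed.

Lemma filter_limit_mu (alpha : Phi (Phi (scott X))) :
  filter_limit X (Phi_map (filter_limit X) alpha) =
  filter_limit X (mu (scott X) alpha).
Proof.
(* By separation it is enough to compare the values of opens, where both limits expand by the join
   formula. *)
apply: scott_T0 => B oB; pose OB := Opens oB.
rewrite [LHS](open_lsup_filter_lower OB) [RHS](open_lsup_filter_lower OB).
apply/eqP; rewrite eq_le; apply/andP; split.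
  apply: joins_le => -[A x] _; apply: (le_joins (i := (A, x))) => //=.
  apply: leI2 => //; apply: filter_mono => u; exact: open_filter_limit_le.
apply: joins_le => -[A x] _ /=; rewrite (scott_open_way_belowE x oB).
rewrite meet_joinsl meet_joinsr; apply: joins_le => y _.
(* The pair [(A, x)] cannot be kept, as [alpha] is now known only on [phi A]; it is replaced by an
   approximant [y << x] with its own open. *)
apply: (le_joins (i := (way_above y, y))) => //=; apply: le_forced => c.
rewrite !lexI => /and3P[aA /andP[By xy] Ax].
rewrite By lower_bounds_way_above !andbT.
(* This is the coefficient of [u A] in the [(A, x)] term of the join formula for [way_above y] at
   the limit of [u]. *)
pose a := way_below x y `&` lower_bounds A x.
have : c <= alpha (opensI (phi A) (opens_cst _ a)).
  by rewrite filterI lexI aA; apply: le_trans (filter_cst _ _); rewrite lexI xy.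
move=> /le_trans; apply; apply: filter_mono => u.
rewrite [leRHS](open_lsup_filter_lower (way_above y)).
exact: (le_joins (i := (A, x))).
Qed.

End ContinuousLattices.

Theorem mainTheorem2 (d : Order.disp_t) (L : frameType d) (X : clattice L) :
  @Phi_algebra d L (scott X) (fun u => lsup (filter_lower u)).
Proof.
split; first exact: scott_T0.
exists (filter_limit X) => //; split; apply/funext => ?.
  exact: filter_limit_mu.
exact: filter_limit_eta.
Qed.
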